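(* Let $k$ be an infinite field, $n\ge 3$, and let $\mathcal{L}$ be an $(n+1)\times n$ general linear matrix over $R=k[X_1,\ldots,X_n]$, with $I=I_n(\mathcal{L})$ the ideal of its $n$-minors and $\phi:R^n\to R^{n+1}$ the map defined by $\mathcal{L}$. Consider the graded complex resolving $I^{n-1}$ $$0\to F_{n-1}\xrightarrow{d_{n-1}}F_{n-2}\to\cdots\to F_1\to F_0\to 0,\qquad F_i=\bigwedge^iR^n\otimes_R\mathcal{S}_{(n-1)-i}(R^{n+1}),$$ with $F_i$ generated in degree $n(n-1)+i$, let $$\eta=d_{n-1}^*:R^N((n+1)(n-1)-1)\to R^n((n+1)(n-1)),\qquad N=(n+1)\binom{n}{2},$$ be the $R$-dual of $d_{n-1}$, and let $M=\mathrm{coker}(\eta)$. Then there is a homogeneous isomorphism $$M(-(n+1)(n-1))\simeq R^n/(X_1,\ldots,X_n)R^n=k^n.$$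
   Context: General linear matrix: let $k$ be an infinite field and $m,n$ positive integers with $m(m-1)\ge n$. Let $\mathcal{Z}=(Z_{ij})$ be the $m\times(m-1)$ generic matrix, $S=k[Z_{ij}\mid 1\le i\le m,\,1\le j\le m-1]$, and $s=m(m-1)-n$. Take a regular sequence $L_1,\ldots,L_s\in S$ of linear forms whose entire set of coefficients is general (random). Then $R:=S/(L_1,\ldots,L_s)$ is a polynomial ring in $n$ variables over $k$, written $R=k[X_1,\ldots,X_n]$, and the general linear matrix $\mathcal{L}$ is the image of $\mathcal{Z}$ over $R$. (Equivalently, ordering entries row by row, the last $n$ entries of $\mathcal{L}$ may be taken to be $X_1,\ldots,X_n$ and the first $m(m-1)-n$ entries are linear forms in the $X_i$ whose total set of coefficients is general.) ''General'' has its usual meaning: an assertion about a general linear matrix means that there is a nonempty Zariski-open subset of the affine space of coefficients of $(L_1,\ldots,L_s)$ such that the assertion holds for every choice of coefficients in it. Here $m=n+1$. $\mathcal{S}_j(-)$ denotes the $j$th symmetric power. With $e_1,\ldots,e_n$ a basis of $R^n$, the differential $F_i\to F_{i-1}$ is given on a basis element $e_{j_1}\wedge\cdots\wedge e_{j_i}\otimes g$ by $$e_{j_1}\wedge\cdots\wedge e_{j_i}\otimes g\mapsto\sum_{l=1}^i(-1)^{l+1}e_{j_1}\wedge\cdots\wedge\widehat{e_{j_l}}\wedge\cdots\wedge e_{j_i}\otimes\phi(e_{j_l})g .$$ Since $I^{n-1}$ is generated in degree $n(n-1)$ and the entries of $\mathcal{L}$ are linear, $F_{n-1}\simeq R^n(-(n+1)(n-1))$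 and $F_{n-2}\simeq R^N(-(n+1)(n-1)+1)$. $M(a)$ denotes the degree shift $M(a)_j=M_{a+j}$. *)

(* Defs.v *)
From HB Require Import structures.
From mathcomp Require Import all_boot all_order all_algebra.
From mathcomp Require Import ring_quotient boolp.
From mathcomp Require Import mpoly.

Set Implicit Arguments.
Unset Strict Implicit.
Unset Printing Implicit Defensive.

Import GRing.Theory.

Local Open Scope ring_scope.
Local Open Scope quotient_scope.

Record submodule (R : nzRingType) (V : lmodType R) := Submodule {
  submod_pred :> {pred V};
  submod_predP : submod_closed submod_pred }.

(* MathComp has the quotient of a Z-module by a subgroup; we add the scaling. *)
Section QuotientModule.
Variables (R : nzRingType) (V : lmodType R) (N : submodule V).

HB.instance Definition _ := GRing.isSubmodClosed.Build R V (submod_pred N)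
  (submod_predP N).

Definition quot_module : Type := Quotient.quot (submod_pred N).

HB.instance Definition _ := Choice.on quot_module.
HB.instance Definition _ := EqQuotient.on quot_module.
HB.instance Definition _ := GRing.Zmodule.on quot_module.
Local Notation Q := quot_module.

Lemma pi_quotD : {morph \pi_Q : u v / u + v}.
Proof. exact: Quotient.pi_add. Qed.

Definition quot_scale (a : R) : Q -> Q := lift_op1 Q ( *:%R a).

Lemma pi_quot_scale a (v : V) : quot_scale a (\pi_Q v) = \pi_Q (a *: v).
Proof.
rewrite /quot_scale; unlock; apply/eqP; rewrite -Quotient.idealrBE -scalerBr.
by apply: rpredZ; rewrite Quotient.idealrBE reprK.
Qed.

Lemma quot_scaleA a b x : quot_scale a (quot_scale b x) = quot_scale (a * b) x.
Proof. by rewrite -[x]reprK !pi_quot_scale scalerA. Qed.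

Lemma quot_scale1 : left_id 1 quot_scale.
Proof. by move=> x; rewrite -[x]reprK pi_quot_scale scale1r. Qed.

Lemma quot_scaleDr : right_distributive quot_scale +%R.
Proof.
move=> a x y; rewrite -[x]reprK -[y]reprK -pi_quotD !pi_quot_scale.
by rewrite scalerDr pi_quotD.
Qed.

Lemma quot_scaleDl x : {morph quot_scale^~ x : a b / a + b}.
Proof.
by move=> a b; rewrite -[x]reprK !pi_quot_scale scalerDl pi_quotD.
Qed.

HB.instance Definition _ := GRing.Zmodule_isLmodule.Build R quot_module
  quot_scaleA quot_scale1 quot_scaleDr quot_scaleDl.

End QuotientModule.

Section Image.
Variables (R : nzRingType) (U V : lmodType R) (f : {linear U -> V}).

Definition image_sub : {pred V} := [pred v | `[< exists u, v = f u >]].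

Lemma image_sub_closed : submod_closed image_sub.
Proof.
split=> [|a x y]; rewrite !inE; first by apply/asboolP; exists 0; rewrite linear0.
move=> /asboolP[u ->] /asboolP[v ->]; apply/asboolP.
by exists (a *: u + v); rewrite linearP.
Qed.

Definition image_submod : submodule V := Submodule image_sub_closed.

End Image.

(* The submodule (X_1, ..., X_n) V. *)
Section IrrelevantSubmodule.
Variables (k : fieldType) (n : nat) (V : lmodType {mpoly k[n]}).

Definition irrel_sub : {pred V} :=
  [pred v | `[< exists f : 'I_n -> V, v = \sum_i 'X_i *: f i >]].

Lemma irrel_sub_closed : submod_closed irrel_sub.
Proof.
split=> [|a x y]; rewrite !inE.
  apply/asboolP; exists (fun=> 0); rewrite big1 // => i _; exact: scaler0.
move=> /asboolP[f ->] /asboolP[g ->]; apply/asboolP.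
exists (fun i => a *: f i + g i); rewrite scaler_sumr -big_split.
by apply: eq_bigr => i _; rewrite scalerDr !scalerA mulrC.
Qed.

Definition irrel_submod : submodule V := Submodule irrel_sub_closed.

End IrrelevantSubmodule.
Arguments irrel_submod {k n} V.

Section GradedModules.
Variables (k : fieldType) (n : nat).
Local Notation R := {mpoly k[n]}.

(* R_t, which is 0 for t < 0. *)
Definition ring_piece (t : int) (p : R) : Prop :=
  match t with Posz d => p \is d.-homog | Negz _ => p = 0 end.

(* A module with its homogeneous pieces M_t. That the pieces form a grading is
   not part of the record; they are spelled out in every instance below. *)
Record gmodule := GModule {
  gmod_sort :> lmodType R;
  piece : int -> gmod_sort -> Prop }.

(* M(a)_t = M_(a + t) *)
Definition gshift (a : int) (M : gmodule) : gmodule :=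
  @GModule M (fun t x => piece (a + t) x).

Definition gquot (M : gmodule) (N : submodule M) : gmodule :=
  @GModule (quot_module N)
    (fun t x => exists v : M, piece t v /\ x = \pi_(quot_module N) v).

Definition graded_iso (M N : gmodule) : Prop :=
  exists f : {linear M -> N},
    bijective f /\ forall t x, piece t x <-> piece t (f x).

Definition gfree (r : nat) : gmodule :=
  @GModule 'cV[R]_r (fun t v => forall i, ring_piece t (v i 0)).

(* F^* = Hom_R(F, R), whose piece of degree t is the maps F_s -> R_(s + t). *)
Definition gdual (F : vectType R) (pieceF : int -> F -> Prop) : gmodule :=
  @GModule 'Hom(F, R^o)
    (fun t al => forall s x, pieceF s x -> ring_piece (s + t) (al x)).

(* k^r, on which R acts through R -> R/(X_1, ..., X_n) = k. *)
Definition residue_space (r : nat) := 'cV[k]_r.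

HB.instance Definition _ r := GRing.Zmodule.on (residue_space r).

Section ResidueSpace.
Variable r : nat.

Definition residue_scale (p : R) (v : residue_space r) : residue_space r :=
  (p@_0%MM *: (v : 'cV[k]_r)).

Lemma residue_scaleA p q v :
  residue_scale p (residue_scale q v) = residue_scale (p * q) v.
Proof. by rewrite /residue_scale scalerA rmorphM. Qed.

Lemma residue_scale1 : left_id 1 residue_scale.
Proof. by move=> v; rewrite /residue_scale mcoeff1 eqxx scale1r. Qed.

Lemma residue_scaleDr : right_distributive residue_scale +%R.
Proof. by move=> p u v; rewrite /residue_scale scalerDr. Qed.

Lemma residue_scaleDl v : {morph residue_scale^~ v : p q / p + q}.
Proof. by move=> p q; rewrite /residue_scale mcoeffD scalerDl. Qed.

HB.instance Definition _ := GRing.Zmodule_isLmodule.Build R (residue_space r)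
  residue_scaleA residue_scale1 residue_scaleDr residue_scaleDl.

End ResidueSpace.

Definition gresidue (r : nat) : gmodule :=
  @GModule (residue_space r) (fun t v => t = 0 \/ v = 0).

End GradedModules.

Section DualMap.
Variables (R : comNzRingType) (U V : vectType R) (f : 'Hom(U, V)).

Definition dual_fun (al : 'Hom(V, R^o)) : 'Hom(U, R^o) := (al \o f)%VF.

Lemma dual_fun_is_linear : linear dual_fun.
Proof.
move=> a x y; apply/lfunP=> u; rewrite /dual_fun.
by rewrite comp_lfunE !add_lfunE !scale_lfunE !comp_lfunE.
Qed.

HB.instance Definition _ := GRing.isLinear.Build R 'Hom(V, R^o) 'Hom(U, R^o) _
  dual_fun dual_fun_is_linear.

Definition dual_map : {linear 'Hom(V, R^o) -> 'Hom(U, R^o)} := dual_fun.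

End DualMap.

(* The modules /\^i R^n (x) S_j(R^(n+1)). An element is the family of its
   coordinates x_J along the basis e_J = e_(j_1) /\ ... /\ e_(j_i) of /\^i R^n,
   J = {j_1 < ... < j_i}, and S_j(R^(n+1)) is the module of forms of degree j in
   n+1 variables over R. The strand i + j = n-1 is the complex F. *)
Section Koszul.
Variables (R : comNzRingType) (n : nat).

Local Notation subsets i := {J : {set 'I_n} | #|J| == i}.

Definition koszul (i j : nat) : Type := {ffun subsets i -> dhomog n.+1 R j}.

HB.instance Definition _ i j := GRing.Lmodule.on (koszul i j).
HB.instance Definition _ i j := Vector.on (koszul i j).

Variable L : 'M[R]_(n.+1, n).

(* phi : R^n -> R^(n+1) = S_1(R^(n+1)) on the basis. *)
Definition phi (a : 'I_n) : {mpoly R[n.+1]} := \sum_i L i a *: 'X_i.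

Lemma phi_homog a : phi a \is 1.-homog.
Proof. by apply: rpred_sum => i _; apply/rpredZ; rewrite dhomogX; apply/eqP/mdeg1. Qed.

Variables i j : nat.

(* e_J (x) g |-> sum_(a in J) (-1)^#{b in J | b < a} e_(J \ a) (x) phi(e_a) g;
   if a is the l-th element of J, then the sign is (-1)^(l+1). *)
Definition koszul_coord (x : koszul i.+1 j) (K : {set 'I_n}) :
    {mpoly R[n.+1]} :=
  \sum_(J : subsets i.+1) \sum_(a in val J | val J :\ a == K)
    (-1) ^+ #|[set b in val J | (b < a)%N]|
      *: (phi a * mpoly_of_dhomog (x J)).

Lemma koszul_coord_homog x K : koszul_coord x K \is j.+1.-homog.
Proof.
apply: rpred_sum => J _; apply: rpred_sum => a _; apply/rpredZ.
by rewrite -[j.+1]add1n; apply: dhomogM; [exact: phi_homog | exact: dhomog_is_dhomog].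
Qed.

Definition koszul_fun (x : koszul i.+1 j) : koszul i j.+1 :=
  [ffun K => DHomog (koszul_coord_homog x (val K))].

Lemma koszul_fun_is_linear : linear koszul_fun.
Proof.
move=> c x y; apply/ffunP=> K; apply: val_inj; rewrite !ffunE /=.
rewrite /koszul_coord scaler_sumr -big_split; apply: eq_bigr => J _ /=.
rewrite scaler_sumr -big_split; apply: eq_bigr => a _ /=.
rewrite !ffunE /= mulrDr scalerDr; congr (_ + _).
by rewrite -scalerAr !scalerA mulrC.
Qed.

HB.instance Definition _ := GRing.isLinear.Build R (koszul i.+1 j)
  (koszul i j.+1) _ koszul_fun koszul_fun_is_linear.

Definition koszul_d : 'Hom(koszul i.+1 j, koszul i j.+1) := linfun koszul_fun.

End Koszul.

Section Cokernel.
Variables (k : fieldType) (n : nat).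
Local Notation R := {mpoly k[n]}.

(* Homogeneous elements of degree t of F_i, i + j = n-1, which is generated in
   degree n(n-1)+i. *)
Definition koszul_piece (i j : nat) (t : int) (x : koszul R n i j) : Prop :=
  forall J m, ring_piece (t - (n * n.-1 + i)%N%:Z) (mpoly_of_dhomog (x J))@_m.

Variable L : 'M[R]_(n.+1, n).

(* The dual of d_(n-1) : F_(n-1) -> F_(n-2); here n >= 2, so that
   (n-2).+1 = n-1. *)
Definition eta : {linear 'Hom(koszul R n n.-2 1, R^o) ->
                         'Hom(koszul R n n.-2.+1 0, R^o)} :=
  dual_map (koszul_d L n.-2 0).

Definition coker_eta : gmodule k n :=
  gquot (M := gdual (@koszul_piece n.-2.+1 0)) (image_submod eta).

End Cokernel.

Section GeneralLinearMatrix.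
Variables (k : fieldType) (n : nat).
(* S = k[Z_ij], the variables Z_ij being ordered row by row by mxvec_index. *)
Local Notation S := {mpoly k[n.+1 * n]}.
Local Notation R := {mpoly k[n]}.
Local Notation s := (n.+1 * n - n)%N.

Definition generic_matrix : 'M[S]_(n.+1, n) :=
  \matrix_(i, j) 'X_(mxvec_index i j).

Definition linear_forms (c : 'M[k]_(s, n.+1 * n)) (r : 'I_s) : S :=
  \sum_v c r v *: 'X_v.

Definition in_ideal (A : comNzRingType) (I : finType) (P : pred I) (g : I -> A)
    (x : A) : Prop :=
  exists f : I -> A, x = \sum_(i | P i) f i * g i.

Definition regular_sequence (A : comNzRingType) (l : nat) (g : 'I_l -> A) :
    Prop :=
  (forall (i : 'I_l) (x : A),
      in_ideal (fun j : 'I_l => (j < i)%N) g (x * g i) ->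
      in_ideal (fun j : 'I_l => (j < i)%N) g x)
  /\ ~ in_ideal predT g 1.

(* L is the image of the generic matrix under S -> S/(L_1, ..., L_s) = R, for
   some identification of graded k-algebras of the quotient with R. *)
Definition linear_section (c : 'M[k]_(s, n.+1 * n)) (L : 'M[R]_(n.+1, n)) :
    Prop :=
  regular_sequence (linear_forms c) /\
  exists pi : {lrmorphism S -> R},
    [/\ forall d p, p \is d.-homog -> pi p \is d.-homog,
        forall q, exists p, pi p = q,
        forall p, pi p = 0 <-> in_ideal predT (linear_forms c) p
      & L = map_mx pi generic_matrix].

Definition zariski_open (a b : nat) (U : 'M[k]_(a, b) -> Prop) : Prop :=
  exists T : {mpoly k[a * b]} -> Prop,
    forall c, U c <-> exists2 p, T p & p.@[fun e => mxvec c 0 e] != 0.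

(* P holds for a general linear matrix. The existence clause says that
   S/(L_1, ..., L_s) is a polynomial ring in n variables for all coefficients
   in U, so that the second clause is never void. *)
Definition for_general_linear_matrix (P : 'M[R]_(n.+1, n) -> Prop) : Prop :=
  exists U : 'M[k]_(s, n.+1 * n) -> Prop,
    [/\ zariski_open U,
        exists c, U c
      & forall c, U c ->
          (exists L, linear_section c L) /\
          (forall L, linear_section c L -> P L)].

End GeneralLinearMatrix.

(* Main.v *)
Require Import Defs.
From HB Require Import structures.
From mathcomp Require Import all_boot all_order all_algebra.
From mathcomp Require Import ring_quotient boolp.
From mathcomp Require Import mpoly.

(** Write f_c for the dual basis of F_(n-1) = /\^(n-1) R^n, where f_c is dual to
    the wedge of all the e_b with b != c, with the sign (-1)^c.  With these
    signs the dual of the last Koszul differential takes the dual basis of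
    F_(n-2) to the vectors
      +- (L_ib f_c - L_ic f_b),   i a row, b != c two columns,
    so that coker eta is R^n modulo these N = (n+1) binomial(n, 2) vectors with
    linear entries.  They lie in (X_1, ..., X_n) R^n; the theorem says that for
    general L they span all of (X_1, ..., X_n) R^n, that is, that over k they
    span the n^2-dimensional space R_1 (x) k^n (here N >= n^2 needs n >= 3).

    This spanning condition is read off the coefficients of the linear forms
    L_1, ..., L_s without choosing coordinates on S/(L_1, ..., L_s): let V be
    the space of linear forms in the Z_ij.  It is enough that the universal
    vectors Z_ib f_c - Z_ic f_b together with L_r f_c span V (x) k^n, since a
    section S -> R kills the L_r and maps V onto R_1 ([section_span]).  Being a
    full-rank condition on a matrix whose entries are polynomial in these
    coefficients, it is open, and so is the independence of the L_r ([spanning_is_open]).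

    The open set is nonempty because of one sparse matrix
    ([spanning_example]): row i <= n has the single nonzero entry X_i, at
    column i, and the last row is (X_2, X_3, ..., X_n, X_1).  Row b gives
    X_b f_c for all c != b.  The columns b, b+1 of the last row give
    X_(b+1) f_(b+1) - X_(b+2) f_b, and here b+2 != b because n >= 3, so that
    the second term is known and the diagonal vectors X_c f_c follow.

    For independent L_r, the quotient S/(L_1, ..., L_s) is a polynomial ring:
    after a linear change of variables the L_r are variables.  This is carried
    out with linear substitutions, which give both the regularity of the
    sequence and the section ([linear_section_exists]). *)

Set Implicit Arguments.
Unset Strict Implicit.
Unset Printing Implicit Defensive.

Import GRing.Theory.

Local Open Scope ring_scope.
Local Open Scope quotient_scope.

(** * Linear substitutions and sections of the generic matrix *)

(** Splitting 0 -> k^s -> k^D -> k^t -> 0: independent rows [c] extend to a basis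
    of k^D, and [H], [A], [E] are the blocks of the change of basis and its
    inverse.  It gives both the coordinates on the quotient by the rows of [c]
    and, for the example, the linear forms cutting out a given section. *)
Lemma row_free_split (k : fieldType) (s t D : nat) (c : 'M[k]_(s, D)) :
  (s + t = D)%N -> row_free c ->
  exists H : 'M[k]_(D, s), exists A : 'M[k]_(D, t), exists E : 'M[k]_(t, D),
    [/\ c *m H = 1%:M, c *m A = 0, E *m A = 1%:M & H *m c + A *m E = 1%:M].
Proof.
move=> defD; subst D => /eqP c_free.
pose U := row_ebase c; pose V := col_ebase c.
have uU : U \in unitmx := row_ebase_unit c.
have uV : V \in unitmx := col_ebase_unit c.
have defc : c = V *m row_mx 1%:M 0 *m U.
  by rewrite -[LHS]mulmx_ebase c_free pid_mx_row.
exists (invmx U *m col_mx 1%:M 0 *m invmx V).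
exists (invmx U *m col_mx 0 1%:M), (row_mx 0 1%:M *m U).
rewrite {}defc; split.
- rewrite !mulmxA mulmxK // -(mulmxA V) mul_row_col mulmx1 mulmx0 addr0 mulmx1.
  exact: mulmxV.
- rewrite !mulmxA mulmxK // -mulmxA mul_row_col mul0mx mulmx0 addr0.
  exact: mulmx0.
- by rewrite !mulmxA mulmxK // mul_row_col mulmx1 mulmx0 add0r.
rewrite !mulmxA mulmxKV // -mulmxDl -!(mulmxA (invmx U)) -mulmxDr.
rewrite !mul_col_row !mul1mx !mul0mx add_block_mx !addr0 !add0r.
by rewrite -scalar_mx_block mulmx1 mulVmx.
Qed.

Section IdealMembership.
Variables (A : comNzRingType) (I : finType) (P : pred I) (g : I -> A).

Lemma in_ideal0 : in_ideal P g 0.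
Proof. by exists (fun=> 0); rewrite big1 // => i _; rewrite mul0r. Qed.

Lemma in_idealD x y : in_ideal P g x -> in_ideal P g y -> in_ideal P g (x + y).
Proof.
move=> [f ->] [h ->]; exists (fun i => f i + h i); rewrite -big_split.
by apply: eq_bigr => i _; rewrite mulrDl.
Qed.

Lemma in_idealM a x : in_ideal P g x -> in_ideal P g (a * x).
Proof.
move=> [f ->]; exists (fun i => a * f i); rewrite mulr_sumr.
by apply: eq_bigr => i _; rewrite mulrA.
Qed.

Lemma in_ideal_sum J (r : seq J) (Q : pred J) (F : J -> A) :
  (forall j, Q j -> in_ideal P g (F j)) ->
  in_ideal P g (\sum_(j <- r | Q j) F j).
Proof.
move=> hF; elim/big_rec: _ => [|j x /hF]; first exact: in_ideal0.
exact: in_idealD.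
Qed.

Lemma in_ideal_gen i : P i -> in_ideal P g (g i).
Proof.
move=> Pi; exists (fun j => (j == i)%:R); rewrite (bigD1 i) //=.
rewrite eqxx mul1r big1 ?addr0 //.
by move=> j /andP[_ /negPf->]; rewrite mul0r.
Qed.

Lemma in_ideal_kernel (B : comNzRingType) (f : {rmorphism A -> B}) x :
  (forall i, P i -> f (g i) = 0) -> in_ideal P g x -> f x = 0.
Proof.
move=> fg0 [h ->]; rewrite rmorph_sum big1 // => i Pi.
by rewrite rmorphM fg0 // mulr0.
Qed.

End IdealMembership.

Section LinearForms.
Variable k : fieldType.

Definition row_form (D t : nat) (A : 'M[k]_(D, t)) (v : 'I_D) : {mpoly k[t]} :=
  \sum_j A v j *: 'X_j.

Lemma row_form_homog D t (A : 'M[k]_(D, t)) v : row_form A v \is 1.-homog.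
Proof.
apply: rpred_sum => i _; apply/rpredZ; rewrite dhomogX; exact/eqP/mdeg1.
Qed.

Lemma row_form_mul D t u (A : 'M[k]_(D, t)) (B : 'M[k]_(t, u)) v :
  row_form (A *m B) v = \sum_j A v j *: row_form B j.
Proof.
rewrite /row_form; under [RHS]eq_bigr do rewrite scaler_sumr.
rewrite exchange_big; apply: eq_bigr => l _ /=; rewrite mxE scaler_suml.
by apply: eq_bigr => j _; rewrite scalerA.
Qed.

Lemma row_formD D t (A B : 'M[k]_(D, t)) v :
  row_form (A + B) v = row_form A v + row_form B v.
Proof. by rewrite -big_split; apply: eq_bigr => j _; rewrite mxE scalerDl. Qed.

Lemma row_form0 D t v : row_form (0 : 'M[k]_(D, t)) v = 0.
Proof. by apply: big1 => j _; rewrite mxE scale0r. Qed.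

Lemma row_form1 D v : row_form (1%:M : 'M[k]_D) v = 'X_v.
Proof.
rewrite /row_form (bigD1 v) //= mxE eqxx scale1r big1 ?addr0 // => j neq.
by rewrite mxE eq_sym (negPf neq) scale0r.
Qed.

Lemma mcoeff_row_form D t (A : 'M[k]_(D, t)) v j :
  (row_form A v)@_U_(j) = A v j.
Proof.
rewrite raddf_sum (bigD1 j) //= mcoeffZ mcoeffX eqxx mulr1 big1 ?addr0 //.
by move=> l neq; rewrite mcoeffZ mcoeffX eq_mnm1 (negPf neq) mulr0.
Qed.

Definition lin_subst (D t : nat) (A : 'M[k]_(D, t)) :
    {mpoly k[D]} -> {mpoly k[t]} :=
  comp_mpoly [tuple row_form A v | v < D].

HB.instance Definition _ D t (A : 'M[k]_(D, t)) :=
  GRing.LRMorphism.on (lin_subst A).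

Lemma lin_substX D t (A : 'M[k]_(D, t)) v : lin_subst A 'X_v = row_form A v.
Proof. by rewrite /lin_subst comp_mpolyXU -tnth_nth tnth_mktuple. Qed.

Lemma lin_subst_form r D t (B : 'M[k]_(r, D)) (A : 'M[k]_(D, t)) i :
  lin_subst A (row_form B i) = row_form (B *m A) i.
Proof.
rewrite row_form_mul {1}/row_form linear_sum; apply: eq_bigr => j _.
by rewrite linearZ /= lin_substX.
Qed.

Lemma lin_subst_homog D t (A : 'M[k]_(D, t)) d p :
  p \is d.-homog -> lin_subst A p \is d.-homog.
Proof.
move=> /dhomogP hp; rewrite /lin_subst comp_mpolyEX big_seq_cond.
apply: rpred_sum => m /andP[/hp <- _]; apply: rpredZ; rewrite comp_mpolyX.
suff h : \prod_(i < D) tnth [tuple row_form A v | v < D] i ^+ m i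
    \is (\sum_i m i)%N.-homog by move: h; rewrite -mdegE.
elim/big_rec2: _ => [|v e q _ hq]; first exact: dhomog1.
apply: dhomogM => //; rewrite tnth_mktuple -[X in X.-homog]mul1n.
exact/dhomogMn/row_form_homog.
Qed.

Lemma mpoly_subst_ind (D : nat) (K : {mpoly k[D]} -> Prop) :
  (forall c, K c%:MP) -> (forall v, K 'X_v) ->
  (forall p q, K p -> K q -> K (p + q)) ->
  (forall p q, K p -> K q -> K (p * q)) ->
  forall p, K p.
Proof.
move=> hC hX hD hM p; rewrite [p]mpolyE.
elim/big_rec: _ => [|m q _ hq]; first by rewrite -mpolyC0.
apply: (hD) hq; rewrite -mul_mpolyC; apply: (hM) => //; rewrite mpolyXE_id.
elim/big_rec: _ => [|v q' _ hq']; first by rewrite -mpolyC1.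
apply: (hM) hq'; elim: (m v) => [|e IH]; rewrite ?expr0 -?mpolyC1 // exprS.
exact: hM.
Qed.

(** Both sides are ring morphisms to the quotient by the ideal, so it suffices to
    compare them on constants and variables. *)
Lemma mpoly_congr_mod D (f : {rmorphism {mpoly k[D]} -> {mpoly k[D]}})
    (I : finType) (P : pred I) (g : I -> {mpoly k[D]}) :
  (forall c, f c%:MP = c%:MP) -> (forall v, in_ideal P g ('X_v - f 'X_v)) ->
  forall p, in_ideal P g (p - f p).
Proof.
move=> fC fX; elim/mpoly_subst_ind => [c|v|p q hp hq|p q hp hq] //.
- by rewrite fC subrr; apply: in_ideal0.
- by rewrite rmorphD opprD addrACA; apply: in_idealD.
rewrite rmorphM.
have ->: p * q - f p * f q = q * (p - f p) + f p * (q - f q).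
  by rewrite !mulrBr addrA (mulrC q p) (mulrC q (f p)) subrK.
by apply: in_idealD; apply: in_idealM.
Qed.

Lemma lin_substC D t (A : 'M[k]_(D, t)) c : lin_subst A c%:MP = c%:MP.
Proof. exact: comp_mpolyC. Qed.

Lemma lin_subst_comp D t u (A : 'M[k]_(D, t)) (B : 'M[k]_(t, u)) p :
  lin_subst B (lin_subst A p) = lin_subst (A *m B) p.
Proof.
elim/mpoly_subst_ind: p => [c|v|p q hp hq|p q hp hq].
- by rewrite !lin_substC.
- by rewrite !lin_substX lin_subst_form.
- by rewrite !linearD /= hp hq.
by rewrite !rmorphM /= hp hq.
Qed.

Lemma lin_subst1 D p : lin_subst (1%:M : 'M[k]_D) p = p.
Proof.
elim/mpoly_subst_ind: p => [c|v|p q hp hq|p q hp hq].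
- by rewrite !lin_substC.
- by rewrite !lin_substX row_form1.
- by rewrite !linearD /= hp hq.
by rewrite !rmorphM /= hp hq.
Qed.

End LinearForms.

Section LinearSections.
Variables (k : fieldType) (n : nat).
Local Notation s := (n.+1 * n - n)%N.

Lemma dim_split : (s + n = n.+1 * n)%N.
Proof. by rewrite subnK // leq_pmull. Qed.

Lemma in_ideal_row_form D r (P : pred 'I_r) (c : 'M[k]_(r, D))
    (B : 'M[k]_(D, r)) v :
  (forall i, ~~ P i -> B v i = 0) ->
  in_ideal P (row_form c) (row_form (B *m c) v).
Proof.
move=> B0; rewrite row_form_mul; apply: in_ideal_sum => i _.
have [Pi|/B0->] := boolP (P i); last by rewrite scale0r; apply: in_ideal0.
by rewrite -mul_mpolyC; apply/in_idealM/in_ideal_gen.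
Qed.

(** For a set [P] of rows let [Q P] be the projection of k^D that kills the rows
    of [c] in [P] and fixes the others.  The substitution by [Q P] is the
    identity modulo the forms in [P] and kills them, so its kernel is exactly
    their ideal; as it fixes the next form, and polynomials have no zero
    divisors, that form is regular modulo the previous ones. *)
Lemma regular_row_forms D r (c : 'M[k]_(r, D)) : row_free c ->
  regular_sequence (row_form c).
Proof.
move=> /mulmxVp; move: (pinvmx c) => H cH1.
pose T (P : pred 'I_r) : 'M[k]_r := diag_mx (\row_i (P i)%:R).
pose Q P : 'M[k]_D := 1%:M - H *m T P *m c.
have cQ P : c *m Q P = (1%:M - T P) *m c.
  by rewrite mulmxBr mulmx1 !mulmxA cH1 mul1mx mulmxBl mul1mx.
have cQrow P i : row_form (c *m Q P) i = (~~ P i)%:R *: row_form c i.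
  rewrite cQ row_form_mul (bigD1 i) //= big1 ?addr0 => [|j neq].
    by rewrite !mxE eqxx mulr1n; case: (P i); rewrite ?subrr ?subr0.
  by rewrite !mxE eq_sym (negPf neq) mulr0n subr0 scale0r.
have Qmod P p : in_ideal P (row_form c) (p - lin_subst (Q P) p).
  apply: mpoly_congr_mod => [a|v]; first exact: lin_substC.
  rewrite /= lin_substX -{1}row_form1 -[1%:M](subrK (H *m T P *m c)).
  rewrite row_formD [X in X - _]addrC.
  rewrite addrK; apply: in_ideal_row_form => i nPi; rewrite mxE big1 // => j _.
  by rewrite !mxE; case: eqP => [->|_]; rewrite ?(negPf nPi) ?mulr0n mulr0.
have Qker (P : pred 'I_r) p :
    in_ideal P (row_form c) p -> lin_subst (Q P) p = 0.
  apply: in_ideal_kernel => i Pi; rewrite /= lin_subst_form cQrow Pi.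
  exact: scale0r.
split=> [i x /Qker|/Qker/eqP]; last by rewrite rmorph1 oner_eq0.
rewrite rmorphM /= lin_subst_form cQrow ltnn scale1r => /eqP.
rewrite mulf_eq0 => /orP[/eqP x0|/eqP ci0].
  by have := Qmod (fun j : 'I_r => (j < i)%N) x; rewrite x0 subr0.
have /matrixP/(_ i i) := cH1.
rewrite !mxE eqxx big1 => [/esym/eqP|j _]; first by rewrite oner_eq0.
by rewrite -(mcoeff_row_form c) ci0 mcoeff0 mul0r.
Qed.

(** The substitution by [A] kills exactly the ideal of the forms because the
    substitution by [A *m E] = 1 - [H *m c] is the identity modulo this ideal. *)
Lemma linear_section_exists (c : 'M[k]_(s, n.+1 * n)) :
  row_free c -> exists L, linear_section c L.
Proof.
move=> c_free.
have [H [A [E [cH1 cA0 EA1 HcAE]]]] := row_free_split dim_split c_free.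
exists (map_mx (lin_subst A) (generic_matrix k n)).
split; first exact: regular_row_forms.
exists (lin_subst A); split=> // [d p|q|p].
- exact: lin_subst_homog.
- by exists (lin_subst E q); rewrite /= lin_subst_comp EA1 lin_subst1.
split=> [p0|]; last first.
  apply: in_ideal_kernel => i _.
  by rewrite /= (lin_subst_form c) cA0 row_form0.
have: in_ideal predT (linear_forms c) (p - lin_subst (A *m E) p).
  apply: mpoly_congr_mod => [a|v]; first exact: lin_substC.
  rewrite /= lin_substX -row_form1 -HcAE row_formD addrK.
  exact: in_ideal_row_form.
by rewrite -lin_subst_comp p0 raddf0 subr0.
Qed.

End LinearSections.

(** * Openness and nonemptiness of the spanning condition *)

Section PolynomialFunctions.
Variables (k : fieldType) (a b : nat).
Implicit Types f g : 'M[k]_(a, b) -> k.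

Definition polynomial_fun f : Prop :=
  exists p : {mpoly k[a * b]}, forall c, f c = p.@[fun e => mxvec c 0 e].

Lemma polynomial_const x : polynomial_fun (fun=> x).
Proof. by exists x%:MP => c; rewrite mevalC. Qed.

Lemma polynomial_entry i j : polynomial_fun (fun c => c i j).
Proof. by exists 'X_(mxvec_index i j) => c; rewrite mevalXU mxvecE. Qed.

Lemma polynomialD f g :
  polynomial_fun f -> polynomial_fun g -> polynomial_fun (fun c => f c + g c).
Proof. by move=> [p hp] [q hq]; exists (p + q) => c; rewrite mevalD hp hq. Qed.

Lemma polynomialM f g :
  polynomial_fun f -> polynomial_fun g -> polynomial_fun (fun c => f c * g c).
Proof. by move=> [p hp] [q hq]; exists (p * q) => c; rewrite mevalM hp hq. Qed.

Lemma polynomial_sum I (r : seq I) (F : I -> 'M[k]_(a, b) -> k) :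
  (forall i, polynomial_fun (F i)) ->
  polynomial_fun (fun c => \sum_(i <- r) F i c).
Proof.
move=> /choice[p hp]; exists (\sum_(i <- r) p i) => c.
by rewrite raddf_sum; apply: eq_bigr.
Qed.

Lemma polynomial_prod I (r : seq I) (F : I -> 'M[k]_(a, b) -> k) :
  (forall i, polynomial_fun (F i)) ->
  polynomial_fun (fun c => \prod_(i <- r) F i c).
Proof.
move=> /choice[p hp]; exists (\prod_(i <- r) p i) => c.
by rewrite rmorph_prod; apply: eq_bigr.
Qed.

Lemma polynomial_det d (A : 'M[k]_(a, b) -> 'M[k]_d) :
  (forall i j, polynomial_fun (fun c => A c i j)) ->
  polynomial_fun (fun c => \det (A c)).
Proof.
move=> hA; apply: polynomial_sum => s.
by apply: polynomialM; [exact: polynomial_const | exact: polynomial_prod].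
Qed.

Lemma zariski_open_neq0 f : polynomial_fun f -> zariski_open (fun c => f c != 0).
Proof.
move=> [p hp]; exists (eq p) => c; rewrite hp.
by split=> [|[_ <-]] //; exists p.
Qed.

End PolynomialFunctions.

Section KoszulRelations.
Variables (k : fieldType) (n : nat).
Local Notation D := (n.+1 * n)%N.
Local Notation s := (D - n)%N.
Local Notation index := ('I_n.+1 * 'I_n * 'I_n)%type.

(** V (x) k^n is the space of matrices with rows indexed by the variables Z_ij.
    For t = (i, b, c) this is the vector Z_ib f_c - Z_ic f_b. *)
Definition generic_relation (t : index) : 'M[k]_(D, n) :=
  let: (i, b, c) := t in
  delta_mx (mxvec_index i b) c - delta_mx (mxvec_index i c) b.

Definition relation_comb (P : index -> k) : 'M[k]_(D, n) :=
  \sum_t P t *: generic_relation t.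

(** The term [c^T *m Y] ranges over the span of the vectors L_r f_b. *)
Definition spanned (c : 'M[k]_(s, D)) (W : 'M[k]_(D, n)) : Prop :=
  exists P, exists Y, W = relation_comb P + c^T *m Y.

Lemma relation_comb_sum I (r : seq I) (x : I -> k) (P : I -> index -> k) :
  \sum_(j <- r) x j *: relation_comb (P j) =
  relation_comb (fun t => \sum_(j <- r) x j * P j t).
Proof.
rewrite /relation_comb; under eq_bigr do rewrite scaler_sumr.
rewrite exchange_big; apply: eq_bigr => t _ /=; rewrite scaler_suml.
by apply: eq_bigr => j _; rewrite scalerA.
Qed.

Lemma spanned_sum I (r : seq I) c (x : I -> k) (W : I -> 'M[k]_(D, n)) :
  (forall j, spanned c (W j)) -> spanned c (\sum_(j <- r) x j *: W j).
Proof.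
move=> /choice[P /choice[Y hW]].
exists (fun t => \sum_(j <- r) x j * P j t), (\sum_(j <- r) x j *: Y j).
rewrite -relation_comb_sum mulmx_sumr -big_split; apply: eq_bigr => j _ /=.
by rewrite -scalemxAr -scalerDr -hW.
Qed.

(** Fixing the coefficients that express the standard basis at [c0] gives a
    square matrix [Psi c], polynomial in [c], with [Psi c0] = 1; wherever its
    determinant does not vanish, the spanning property persists.  In the same
    way [c *m D1], with [D1] a right inverse of [c0], controls independence. *)
Lemma spanning_is_open (c0 : 'M[k]_(s, D)) :
  row_free c0 -> (forall W, spanned c0 W) ->
  exists U : 'M[k]_(s, D) -> Prop,
    [/\ zariski_open U, U c0
      & forall c, U c -> row_free c /\ forall W, spanned c W].
Proof.
move=> c0_free c0_span.
pose D1 := pinvmx c0.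
have [P /choice[Y hPY]] := choice (fun e => c0_span (vec_mx (row e 1%:M))).
pose Psi (c : 'M[k]_(s, D)) : 'M[k]_(D * n) :=
  \matrix_e mxvec (relation_comb (P e) + c^T *m Y e).
have Psi0 : Psi c0 = 1%:M.
  by apply/row_matrixP => e; rewrite rowK -hPY vec_mxK.
exists (fun c => \det (c *m D1) * \det (Psi c) != 0); split.
- apply: zariski_open_neq0; apply: polynomialM; apply: polynomial_det => i j.
    under eq_fun do rewrite mxE; apply: polynomial_sum => l.
    by apply: polynomialM; [exact: polynomial_entry | exact: polynomial_const].
  case/mxvec_indexP: j => v l; under eq_fun do rewrite mxE mxvecE mxE.
  apply: polynomialD; first exact: polynomial_const.
  under eq_fun do rewrite mxE; apply: polynomial_sum => r.
  under eq_fun do rewrite mxE.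
  by apply: polynomialM; [exact: polynomial_entry | exact: polynomial_const].
- by rewrite Psi0 mulmxVp // !det1 mulr1 oner_eq0.
move=> c; rewrite mulf_eq0 negb_or => /andP[det1 det2]; split.
  apply/row_freeP; exists (D1 *m invmx (c *m D1)).
  by rewrite mulmxA mulmxV // unitmxE unitfE.
move=> W; have uPsi : Psi c \in unitmx by rewrite unitmxE unitfE.
rewrite -[W]mxvecK -[mxvec W](mulmxKV uPsi) mulmx_sum_row linear_sum.
under eq_bigr do rewrite linearZ /= rowK mxvecK.
by apply: spanned_sum => e; exists (P e), (Y e).
Qed.

(** The matrix of [sparse_entry j] holds the coefficients of X_j in the sparse
    linear matrix: X_i at (i, i) for i < n, and X_(b+1) at (n, b), the column
    index being taken cyclically. *)
Definition sparse_entry (j : 'I_n) : 'M[k]_(n.+1, n) :=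
  \matrix_(i, b)
    (if i == ord_max then j == ordS b else (i == j :> nat) && (j == b))%:R.

Definition sparse_coef : 'M[k]_(n, D) := \matrix_j mxvec (sparse_entry j).

Lemma sparse_coefE j i b : sparse_coef j (mxvec_index i b) =
  (if i == ord_max then j == ordS b else (i == j :> nat) && (j == b))%:R.
Proof. by rewrite mxE mxvecE mxE. Qed.

Lemma mulmx_delta a d e (A : 'M[k]_(a, d)) v c :
  A *m delta_mx v c = \sum_j A j v *: delta_mx j c :> 'M_(a, e).
Proof.
rewrite -[delta_mx v c](mul_delta_mx (0 : 'I_1)) mulmxA -colE.
apply/matrixP => i l; rewrite summxE mxE big_ord1 !mxE (bigD1 i) //=.
rewrite !mxE !eqxx /=.
by rewrite big1 ?addr0 // => j neq; rewrite !mxE eq_sym (negPf neq) mulr0.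
Qed.

Lemma sparse_diag (b : 'I_n) d c :
  sparse_coef *m delta_mx (mxvec_index (widen_ord (leqnSn n) b) d) c =
  (b == d)%:R *: delta_mx b c :> 'M_n.
Proof.
rewrite mulmx_delta (bigD1 b) //= big1 ?addr0 => [|j neq]; rewrite sparse_coefE.
  by rewrite ifN ?eqxx // -val_eqE neq_ltn /= ltn_ord.
rewrite ifN -?val_eqE /= 1?eq_sym ?[_ == _ :> nat](negPf neq) ?scale0r //.
by rewrite neq_ltn ltn_ord orbT.
Qed.

Lemma sparse_last d c :
  sparse_coef *m delta_mx (mxvec_index ord_max d) c =
  delta_mx (ordS d) c :> 'M_n.
Proof.
rewrite mulmx_delta (bigD1 (ordS d)) //= big1 ?addr0 => [|j neq].
  by rewrite sparse_coefE !eqxx scale1r.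
by rewrite sparse_coefE eqxx (negPf neq) scale0r.
Qed.

(** Multiplication by [sparse_coef] substitutes the sparse matrix for the Z_ij,
    so that [delta_mx b c] stands for X_b f_c. *)
Lemma sparse_span (n_ge3 : (3 <= n)%N) (M : 'M[k]_n) :
  exists P, sparse_coef *m relation_comb P = M.
Proof.
have relP t : exists P, relation_comb P = generic_relation t.
  exists (fun u => (u == t)%:R); rewrite /relation_comb (bigD1 t) //=.
  by rewrite eqxx scale1r big1 ?addr0 // => u /negPf->; rewrite scale0r.
have offdiag b c : b != c ->
    exists P, sparse_coef *m relation_comb P = delta_mx b c.
  move=> neq; have [P hP] := relP (widen_ord (leqnSn n) b, b, c).
  exists P; rewrite hP mulmxBr !sparse_diag eqxx scale1r (negPf neq) scale0r.
  exact: subr0.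
have comb P Q : exists P', relation_comb P' = relation_comb P + relation_comb Q.
  exists (fun t => P t + Q t); rewrite -big_split.
  by apply: eq_bigr => t _; rewrite scalerDl.
have hb b c : exists P, sparse_coef *m relation_comb P = delta_mx b c.
  have [->{b}|] := eqVneq b c; last exact: offdiag.
  pose d := ord_pred c; have dK : ordS d = c := ord_predK c.
  have [|P hP] := offdiag (ordS c) d.
    rewrite -dK -val_eqE /= -(addn1 (_ %% n)) modnDml addn1 -addn2.
    have := eqn_modDl d 2 0 n; rewrite addn0 (modn_small (ltn_ord d)) => ->.
    by rewrite !modn_small // (leq_trans _ n_ge3).
  (* the last row gives X_c f_c - X_(c+1) f_(c-1), whose second term is known *)
  have [Q hQ] := relP (ord_max, d, c); have [R hR] := comb P Q.
  exists R; rewrite hR mulmxDr hP hQ mulmxBr !sparse_last dK.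
  by rewrite addrC subrK.
have /choice[P hP] : forall u : 'I_n * 'I_n, exists P,
    sparse_coef *m relation_comb P = delta_mx u.1 u.2 by move=> [b c].
exists (fun t => \sum_u M u.1 u.2 * P u t).
rewrite -relation_comb_sum mulmx_sumr.
rewrite [RHS]matrix_sum_delta pair_bigA; apply: eq_bigr => u _ /=.
by rewrite -scalemxAr hP.
Qed.

(** The forms are a basis of the linear relations between the entries of the
    sparse matrix; a vector of V (x) k^n that the sparse matrix sends to 0 is a
    combination of the L_r f_b. *)
Lemma spanning_example (n_ge3 : (3 <= n)%N) :
  exists c0 : 'M[k]_(s, D), row_free c0 /\ forall W, spanned c0 W.
Proof.
have sparse_free : row_free sparse_coef.
  apply/row_freeP; have [P hP] := sparse_span n_ge3 1%:M.
  by exists (relation_comb P).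
have nsD : (n + s = D)%N by rewrite addnC dim_split.
have [H [A [E [_ cA0 EA1 HcAE]]]] := row_free_split nsD sparse_free.
exists A^T; split=> [|W].
  by apply/row_freeP; exists E^T; rewrite -trmx_mul EA1 trmx1.
have [P hP] := sparse_span n_ge3 (sparse_coef *m W).
exists P, (E *m (W - relation_comb P)); rewrite trmxK mulmxA.
rewrite -[A *m E](addKr (H *m sparse_coef)) HcAE mulmxDl mulNmx -mulmxA.
by rewrite mulmxBr hP subrr mulmx0 oppr0 add0r mul1mx addrC subrK.
Qed.
End KoszulRelations.

(** * Quotient modules and the irrelevant submodule *)

Section QuotientMaps.
Variables (R : nzRingType) (V : lmodType R) (N : submodule V).
Local Notation Q := (quot_module N).

Lemma pi_quot_eq0 v : \pi_Q v = 0 <-> v \in submod_pred N.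
Proof.
have <- : \pi_Q 0 = 0.
  rewrite -[X in \pi_Q X](scale0r 0) -pi_quot_scale.
  exact: (scale0r (\pi_Q 0 : Q)).
split=> h; first by rewrite -[v]subr0 Quotient.idealrBE; apply/eqP.
by apply/eqP; rewrite -Quotient.idealrBE subr0.
Qed.

Section Lift.
Variables (W : lmodType R) (g : {linear V -> W}).
Hypotheses (g_onto : forall w, exists v, g v = w).
Hypothesis g_ker : forall v, g v = 0 <-> v \in submod_pred N.

Lemma pi_quot_eq v w : \pi_Q v = \pi_Q w <-> g v = g w.
Proof.
split=> [/eqP|eq_g].
  by rewrite -Quotient.idealrBE => /g_ker/eqP; rewrite raddfB subr_eq0 => /eqP.
by apply/eqP; rewrite -Quotient.idealrBE; apply/g_ker; rewrite raddfB /= eq_g subrr.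
Qed.

Lemma quot_linear_bij :
  exists2 f : {linear Q -> W}, bijective f & forall v, f (\pi_Q v) = g v.
Proof.
have f_pi v : g (repr (\pi_Q v)) = g v by apply/pi_quot_eq; rewrite reprK.
pose f (x : Q) := g (repr x).
have f_linear : linear f.
  move=> a x y; rewrite -[x]reprK -[y]reprK.
  have ->: a *: \pi_Q (repr x) + \pi_Q (repr y) = \pi_Q (a *: repr x + repr y).
    by rewrite pi_quotD -pi_quot_scale.
  by rewrite /f !f_pi linearP.
pose fM := GRing.isLinear.Build R Q W _ f f_linear.
pose fL : {linear Q -> W} := HB.pack f fM.
have [h hK] := choice g_onto.
exists fL; last exact: f_pi.
exists (fun w => \pi_Q (h w)) => [x|w]; last by rewrite /= /f f_pi.
by rewrite -[RHS]reprK; apply/pi_quot_eq; rewrite hK.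
Qed.

End Lift.

End QuotientMaps.

Section ConstantTerms.
Variables (k : fieldType) (n : nat).
Local Notation R := {mpoly k[n]}.

Lemma mcoeff0M (p q : R) : (p * q)@_0 = p@_0 * q@_0.
Proof. exact: rmorphM. Qed.

Lemma irrelevant_ideal (p : R) :
  p@_0 = 0 <-> exists f : 'I_n -> R, p = \sum_i 'X_i * f i.
Proof.
split=> [p0|[f ->]]; last first.
  rewrite raddf_sum /= big1 // => i _.
  by rewrite mcoeff0M mcoeffX mnm1_eq0 mul0r.
suff: in_ideal predT (fun i : 'I_n => 'X_i : R) (p - (p@_0)%:MP).
  rewrite p0 mpolyC0 subr0 => -[f ->]; exists f.
  by apply: eq_bigr => i _; rewrite mulrC.
pose f : {rmorphism R -> R} := @mpolyC n k \o mcoeff 0%MM.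
apply: (@mpoly_congr_mod _ _ f) => [c|v]; rewrite /f /=.
  by rewrite mcoeffC eqxx mulr1.
rewrite mcoeffX mnm1_eq0 mpolyC0 subr0.
exact: (@in_ideal_gen _ _ predT (fun i : 'I_n => 'X_i : R)).
Qed.

Lemma irrel_cVP r (v : 'cV[R]_r) :
  v \in submod_pred (irrel_submod 'cV[R]_r) <-> forall i, (v i 0)@_0 = 0.
Proof.
split=> [|v0].
  rewrite inE => /asboolP[f ->] i; apply/irrelevant_ideal.
  exists (fun j => f j i 0); rewrite summxE; apply: eq_bigr => j _.
  by rewrite mxE.
have /choice[f hf] i := (irrelevant_ideal (v i 0)).1 (v0 i).
rewrite inE; apply/asboolP; exists (fun j => \col_i f i j).
apply/matrixP => i j; rewrite ord1 hf summxE.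
by apply: eq_bigr => l _; rewrite !mxE.
Qed.

Definition const_terms r (v : 'cV[R]_r) : residue_space k r :=
  \col_i (v i 0)@_0.

Lemma const_terms_linear r : linear (@const_terms r).
Proof.
by move=> a u v; apply/matrixP => i j; rewrite !mxE mcoeffD mcoeff0M.
Qed.

HB.instance Definition _ r := GRing.isLinear.Build R 'cV[R]_r
  (residue_space k r) _ (@const_terms r) (@const_terms_linear r).

Lemma dhomog_const d (p : R) : p \is d.-homog -> p@_0 != 0 -> d = 0%N.
Proof.
move=> hp; apply: contraNeq => d_neq0; rewrite (dhomog_nemf_coeff hp) //.
by rewrite /= mdeg0 eq_sym.
Qed.

(** Taking constant terms; a homogeneous vector of degree other than 0 has none. *)
Lemma quot_irrel_residue r :
  graded_iso (gquot (irrel_submod (gfree k n r))) (gresidue k n r).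
Proof.
have onto (w : residue_space k r) : exists v, const_terms v = w.
  exists (\col_i (w i 0)%:MP); apply/matrixP => i j.
  by rewrite !mxE mcoeffC eqxx mulr1 ord1.
have ker (v : gfree k n r) :
    const_terms v = 0 <-> v \in submod_pred (irrel_submod (gfree k n r)).
  split=> [/matrixP v0|/irrel_cVP v0].
    by apply/irrel_cVP => i; have := v0 i 0; rewrite !mxE.
  by apply/matrixP => i j; rewrite !mxE.
have [f f_bij f_pi] := @quot_linear_bij _ _ _ _ (@const_terms r) onto ker.
exists f; split=> // t x; rewrite /= /ring_piece; split.
  move=> [v [vt ->]]; rewrite f_pi.
  have [|t_neq0] := eqVneq t 0; [by left | right].
  apply/matrixP => i j; rewrite !mxE; apply/eqP; apply: contraT => nz.
  case: t vt t_neq0 => [d vt|d vt] d_neq0; last by rewrite vt mcoeff0 eqxx in nz.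
  by rewrite (dhomog_const (vt i) nz) in d_neq0.
case=> [->|fx0].
  have [v hv] := onto (f x).
  exists (\col_i ((v i 0)@_0)%:MP); split=> [i|].
    by rewrite mxE -alg_mpolyC; apply/rpredZ/dhomog1.
  apply: (bij_inj f_bij); rewrite f_pi -hv; apply/matrixP => i j.
  by rewrite !mxE mcoeffC eqxx mulr1.
exists 0; split=> [i|]; last by apply: (bij_inj f_bij); rewrite fx0 f_pi linear0.
by case: t => d; rewrite mxE // dhomog0.
Qed.

End ConstantTerms.

(** * The last two terms of the Koszul strand *)

Section TopKoszul.
Variables (R : comNzRingType) (n : nat).
Hypothesis n_ge2 : (2 <= n)%N.
Local Notation F1 := (koszul R n n.-2.+1 0).
Local Notation F2 := (koszul R n n.-2 1).

Let predn_eq : n.-2.+1 = n.-1.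
Proof. by case: n n_ge2 => [|[]]. Qed.

Lemma one_homog : (1 : {mpoly R[n.+1]}) \is 0.-homog.
Proof. exact: dhomog1. Qed.

(** The basis vector of F_(n-1) on the wedge of all e_b with b != c. *)
Definition top_elt (c : 'I_n) : F1 :=
  [ffun J => if val J == [set~ c] then DHomog one_homog else 0].

Lemma X_homog (i : 'I_n.+1) : ('X_i : {mpoly R[n.+1]}) \is 1.-homog.
Proof. by rewrite dhomogX; apply/eqP/mdeg1. Qed.

(** The basis vector of F_(n-2) on the wedge of all e_b with b != a, c, tensored
    with the i-th basis vector of R^(n+1). *)
Definition sub_elt (a c : 'I_n) (i : 'I_n.+1) : F2 :=
  [ffun K => if val K == ~: [set a; c] then DHomog (X_homog i) else 0].

(** At most one index satisfies the condition; summing avoids carrying the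
    cardinality proof of the complement. *)
Definition top_coord (c : 'I_n) (x : F1) : R :=
  \sum_(J | val J == [set~ c]) (mpoly_of_dhomog (x J))@_0.

Definition sub_coord (a c : 'I_n) (i : 'I_n.+1) (x : F2) : R^o :=
  \sum_(K | val K == ~: [set a; c]) (mpoly_of_dhomog (x K))@_U_(i).

Lemma top_coord_linear c a x y :
  top_coord c (a *: x + y) = a * top_coord c x + top_coord c y.
Proof.
rewrite mulr_sumr -big_split; apply: eq_bigr => J _ /=.
by rewrite !ffunE /= mcoeffD mcoeffZ.
Qed.

Lemma sub_coord_linear b c i : linear (sub_coord b c i).
Proof.
move=> a x y; rewrite scaler_sumr -big_split; apply: eq_bigr => J _ /=.
by rewrite !ffunE /= mcoeffD mcoeffZ.
Qed.

HB.instance Definition _ b c i := GRing.isLinear.Build R F2 R^o _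
  (sub_coord b c i) (sub_coord_linear b c i).

Lemma facet_card (c : 'I_n) : #|[set~ c]| == n.-2.+1.
Proof. by rewrite cardsC1 card_ord predn_eq. Qed.

Lemma facetP (J : {set 'I_n}) : #|J| == n.-2.+1 -> exists c, J = [set~ c].
Proof.
rewrite predn_eq => /eqP cJ.
have /cards1P[c Jc] : #|~: J| == 1%N.
  rewrite cardsCs setCK cJ card_ord.
  by case: n n_ge2 => [|m] _ //; rewrite subSnn.
by exists c; rewrite -Jc setCK.
Qed.

Lemma setC1_inj : injective (fun c : 'I_n => [set~ c]).
Proof. by move=> a b /(can_inj setCK)/set1_inj. Qed.

Lemma top_coord_elt b c : top_coord b (top_elt c) = (b == c)%:R.
Proof.
rewrite /top_coord (bigD1 (Sub [set~ b] (facet_card b))) ?SubK //= big1.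
  rewrite ffunE SubK (inj_eq setC1_inj) addr0.
  by case: eqP => _; rewrite /= ?mcoeff1 ?eqxx ?mcoeff0.
by move=> J /andP[/eqP Jb]; rewrite -val_eqE SubK /= Jb eqxx.
Qed.

Lemma top_expand (x : F1) : x = \sum_c top_coord c x *: top_elt c.
Proof.
apply/ffunP => J; rewrite sum_ffunE; have [c Jc] := facetP (valP J).
rewrite (bigD1 c) //= big1 => [|b neq]; last first.
  by rewrite !ffunE Jc (inj_eq setC1_inj) eq_sym (negPf neq) scaler0.
rewrite addr0 ffunE ffunE Jc eqxx; apply: val_inj => /=.
rewrite /top_coord (bigD1 J) /= ?Jc // big1 => [|K /andP[/eqP Kc]]; last first.
  by rewrite -val_eqE /= Kc Jc eqxx.
rewrite addr0; apply/mpolyP => m; rewrite mcoeffZ mcoeff1.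
have [->|m0] := eqVneq m 0%MM; first by rewrite mulr1.
rewrite mulr0 (dhomog_nemf_coeff (dhomog_is_dhomog (x J))) //.
by rewrite /= mdeg_eq0.
Qed.

Lemma card_pred_other (b c : 'I_n) :
  (#|[set x in [set~ c] | (x < b)%N]| + (c < b) = b)%N.
Proof.
have {3}<- : #|[set x : 'I_n | (x < b)%N]| = b.
  rewrite -sum1dep_card -(big_ord_widen n (fun=> 1%N)) ?sum1_card ?card_ord //.
  exact: ltnW.
rewrite [RHS](cardsD1 c) inE addnC; congr (_ + _)%N.
by apply: eq_card => x; rewrite !inE.
Qed.

Variable L : 'M[R]_(n.+1, n).

Definition koszul_sign (c a : 'I_n) : R :=
  (-1) ^+ #|[set x in [set~ c] | (x < a)%N]|.

(** After multiplication by (-1)^c, the sign with which e_b is removed from the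
    wedge omitting e_c is antisymmetric in b and c; this is why the signed dual
    basis turns the differential into the differences L_ib f_c - L_ic f_b. *)
Lemma koszul_signE (b c : 'I_n) :
  (-1) ^+ c * koszul_sign c b = (-1) ^+ (b + c) * (-1) ^+ (c < b).
Proof.
have := card_pred_other b c; rewrite /koszul_sign; set d := #|_| => hb.
have ->: (b + c = d + (c < b) + c)%N by rewrite hb.
rewrite !exprD mulrC; case: (c < b)%N; rewrite ?expr0 ?mulr1 // expr1.
by rewrite !mulrN1 mulNr opprK.
Qed.

Lemma facetD1 (a c : 'I_n) : [set~ c] :\ a = ~: [set a; c].
Proof. by apply/setP => x; rewrite !inE negb_or. Qed.

Lemma koszul_d_top c : koszul_d L n.-2 0 (top_elt c) =
  \sum_(a | a != c) \sum_i (koszul_sign c a * L i a) *: sub_elt a c i.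
Proof.
apply/ffunP => K; apply: val_inj; rewrite lfunE /= !ffunE /= /koszul_coord.
rewrite (bigD1 (Sub [set~ c] (facet_card c))) //=.
rewrite [X in _ + X]big1 => [|J]; last first.
  rewrite -val_eqE SubK => /negPf Jc; apply: big1 => a _.
  by rewrite ffunE Jc mulr0 scaler0.
rewrite addr0 ffunE eqxx /= sum_ffunE linear_sum /=.
rewrite big_mkcondr /=; apply: eq_big => [a|a _]; first by rewrite !inE.
rewrite sum_ffunE linear_sum /= facetD1 eq_sym; case: eqP => [Ka|/eqP Ka].
  rewrite mulr1 scaler_sumr; apply: eq_bigr => i _.
  by rewrite !ffunE /= Ka eqxx scalerA.
by rewrite big1 // => i _; rewrite !ffunE /= (negPf Ka) scaler0.
Qed.

Lemma ridge_card (a b : 'I_n) : a != b -> #|~: [set a; b]| == n.-2.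
Proof. by move=> neq; rewrite cardsCs setCK cards2 neq card_ord subn2. Qed.

Lemma sub_coord_elt a b c e i j : a != b ->
  sub_coord a b i (sub_elt c e j) = (([set c; e] == [set a; b]) && (i == j))%:R.
Proof.
move=> neq; rewrite /sub_coord.
rewrite (bigD1 (Sub (~: [set a; b]) (ridge_card neq))) ?SubK //= big1.
  rewrite ffunE SubK (inj_eq (can_inj setCK)) addr0 eq_sym.
  case: eqP => _; rewrite /= ?mcoeff0 // mcoeffX eq_mnm1 eq_sym.
  by case: eqP.
by move=> K /andP[/eqP Kab]; rewrite -val_eqE SubK /= Kab eqxx.
Qed.

(** Coordinates on the basis f_c of the dual of F_(n-1). *)
Definition top_dual (al : 'Hom(F1, R^o)) : 'cV[R]_n :=
  \col_c ((-1) ^+ c * al (top_elt c)).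

Lemma top_dual_linear : linear top_dual.
Proof.
move=> a x y; apply/matrixP => i j; rewrite !mxE add_lfunE scale_lfunE mulrDr.
by rewrite mulrCA.
Qed.

HB.instance Definition _ := GRing.isLinear.Build R 'Hom(F1, R^o) 'cV[R]_n _
  top_dual top_dual_linear.

Lemma top_dual_eval (al : 'Hom(F1, R^o)) x :
  al x = \sum_c top_coord c x * ((-1) ^+ c * top_dual al c 0).
Proof.
rewrite {1}[x]top_expand linear_sum; apply: eq_bigr => c _.
by rewrite linearZ /= mxE signrMK.
Qed.

Lemma top_dual_inj : injective top_dual.
Proof. by move=> al be eq_ab; apply/lfunP => x; rewrite !top_dual_eval eq_ab. Qed.

Lemma top_dual_onto v : exists al, top_dual al = v.
Proof.
pose f (x : F1) : R^o := \sum_c top_coord c x * ((-1) ^+ c * v c 0).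
have f_linear : linear f.
  move=> a x y; rewrite /f scaler_sumr -big_split; apply: eq_bigr => c _ /=.
  by rewrite top_coord_linear mulrDl -mulrA.
pose fM := GRing.isLinear.Build R F1 R^o _ f f_linear.
pose fL : {linear F1 -> R^o} := HB.pack f fM.
exists (linfun fL); apply/matrixP => c j; rewrite ord1 mxE lfunE /= /f.
rewrite (bigD1 c) //= big1 => [|b neq].
  by rewrite addr0 top_coord_elt eqxx mul1r signrMK.
by rewrite top_coord_elt (negPf neq) mul0r.
Qed.

Lemma set2_eqP (a b c e : 'I_n) : b != c ->
  ([set a; e] == [set b; c]) && (a != e) =
  (e == c) && (a == b) || (e == b) && (a == c).
Proof.
move=> neq; apply/andP/idP => [[/eqP eqs]|].
  have: a \in [set b; c] by rewrite -eqs !inE eqxx.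
  have: e \in [set b; c] by rewrite -eqs !inE eqxx orbT.
  by rewrite !inE => /orP[]/eqP-> /orP[]/eqP->; rewrite !eqxx ?orbT.
case/orP => /andP[/eqP-> /eqP->]; first by rewrite eqxx.
by rewrite setUC eqxx eq_sym.
Qed.

Lemma top_dual_sub_coord b c i : b != c ->
  top_dual (dual_map (koszul_d L n.-2 0) (linfun (sub_coord b c i))) =
  ((-1) ^+ (b + c) * (-1) ^+ (c < b)) *:
    (L i b *: delta_mx c 0 - L i c *: delta_mx b 0).
Proof.
move=> neq; apply/matrixP => e j; rewrite ord1 {j}.
rewrite !mxE /= /dual_fun comp_lfunE lfunE /= koszul_d_top.
have ->: sub_coord b c i (\sum_(a | a != e) \sum_i0
     (koszul_sign e a * L i0 a) *: sub_elt a e i0) =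
   \sum_a if (e == c) && (a == b) || (e == b) && (a == c)
           then koszul_sign e a * L i a else 0.
  rewrite linear_sum big_mkcond; apply: eq_bigr => a _ /=.
  rewrite -set2_eqP // andbC; case: ifP => //= ae.
  rewrite linear_sum (bigD1 i) //= big1 => [|j ji].
    rewrite linearZ /= sub_coord_elt // eqxx andbT addr0.
    by case: eqP => _; rewrite /GRing.scale /= ?mulr1 ?mulr0.
  by rewrite linearZ /= sub_coord_elt // [i == j]eq_sym (negPf ji) andbF scaler0.
have [->{e}|ec] := eqVneq e c.
  rewrite eq_sym (negPf neq) /= mulr0 subr0 mulr1 (bigD1 b) //= eqxx orbF big1.
    by rewrite addr0 mulrA koszul_signE.
  by move=> a /negPf->.
have [->{e ec}|eb] := eqVneq e b.
  rewrite /= mulr0 sub0r mulr1 (bigD1 c) //= eqxx big1.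
    rewrite addr0 mulrA koszul_signE addnC mulrN -mulNr; congr (_ * _).
    rewrite -mulrN; congr (_ * _).
    by move: neq; rewrite -val_eqE /=; case: ltngtP => // _ _; rewrite ?opprK.
  by move=> a /negPf->.
by rewrite /= !mulr0 subr0 mulr0 big1 ?mulr0.
Qed.

End TopKoszul.

(** * The cokernel under the spanning condition *)

Section RingPieces.
Variables (k : fieldType) (n : nat).
Local Notation R := {mpoly k[n]}.

Lemma ring_piece0 t : ring_piece t (0 : R).
Proof. by case: t => d //=; apply: dhomog0. Qed.

Lemma ring_pieceD t (p q : R) :
  ring_piece t p -> ring_piece t q -> ring_piece t (p + q).
Proof. by case: t => d /=; [exact: dhomogD | move=> -> ->; rewrite addr0]. Qed.

Lemma ring_piece_sum t I (r : seq I) (P : pred I) (F : I -> R) :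
  (forall i, P i -> ring_piece t (F i)) ->
  ring_piece t (\sum_(i <- r | P i) F i).
Proof.
move=> hF; elim/big_rec: _ => [|i p /hF hi hp]; first exact: ring_piece0.
exact: ring_pieceD.
Qed.

Lemma ring_piece_sign t b (p : R) :
  ring_piece t ((-1) ^+ b * p) <-> ring_piece t p.
Proof.
suff h (q : R) : ring_piece t q -> ring_piece t ((-1) ^+ b * q).
  by split=> /h; rewrite ?signrMK.
rewrite -signr_odd; case: (odd b); rewrite ?mul1r ?expr1 // mulN1r.
by case: t => d /=; [rewrite dhomogN | move=> ->; rewrite oppr0].
Qed.

Lemma ring_pieceM s t (p q : R) :
  ring_piece s p -> ring_piece t q -> ring_piece (s + t) (p * q).
Proof.
case: s t => [d|d] [e|e] /=; first exact: dhomogM.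
- by move=> _ ->; rewrite mulr0; apply: ring_piece0.
- by move=> -> _; rewrite mul0r; apply: ring_piece0.
by move=> -> _; rewrite mul0r.
Qed.

End RingPieces.

Section CokernelIso.
Variables (k : fieldType) (n : nat).
Hypothesis n_ge2 : (2 <= n)%N.
Local Notation R := {mpoly k[n]}.
Local Notation F1 := (koszul R n n.-2.+1 0).
Local Notation top_dual := (@top_dual R n).

Lemma top_degree : (n * n.-1 + n.-2.+1 = n.+1 * n.-1)%N.
Proof. by case: n n_ge2 => [|[|m]] // _; rewrite mulSn addnC. Qed.

(** F_(n-1) is generated by the [top_elt c] in degree (n+1)(n-1). *)
Lemma dual_pieceP t (al : 'Hom(F1, R^o)) :
  piece (g := gdual (@koszul_piece k n n.-2.+1 0))
    (- (n.+1 * n.-1)%N%:Z + t) al <->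
  piece (g := gfree k n n) t (top_dual al).
Proof.
rewrite /= /koszul_piece top_degree; split=> [h c|h s x hx].
  rewrite mxE; apply/ring_piece_sign.
  rewrite -[t](addKr (- (n.+1 * n.-1)%N%:Z)) opprK.
  apply: h => J m; rewrite subrr /= ffunE; case: ifP => _ /=.
    rewrite mcoeff1; case: (m == _); [exact: dhomog1 | exact: dhomog0].
  by rewrite mcoeff0; apply: dhomog0.
rewrite (top_dual_eval n_ge2) addrA; apply: ring_piece_sum => c _.
apply: ring_pieceM; last exact/ring_piece_sign/h.
by apply: ring_piece_sum => J _; apply: hx.
Qed.

Variable L : 'M[R]_(n.+1, n).

Definition row_relation (t : 'I_n.+1 * 'I_n * 'I_n) : 'cV[R]_n :=
  let: (i, b, c) := t in L i b *: delta_mx c 0 - L i c *: delta_mx b 0.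

Hypothesis L_irrel : forall i a, (L i a)@_0 = 0.
Hypothesis L_span : forall j c, exists P,
  'X_j *: delta_mx c 0 = \sum_t P t *: row_relation t.

(** The relations of the rows generate (X_1, ..., X_n) R^n over R since by
    assumption they reach the generators X_j f_c; conversely the differential
    has entries in (X_1, ..., X_n). *)
Lemma image_eta_irrel al : al \in submod_pred (image_submod (Defs.eta L)) <->
  top_dual al \in submod_pred (irrel_submod 'cV[R]_n).
Proof.
split.
  rewrite inE => /asboolP[ga ->]; apply/irrel_cVP => c.
  rewrite mxE /= /dual_fun comp_lfunE (koszul_d_top n_ge2) mcoeff0M.
  rewrite linear_sum raddf_sum big1 ?mulr0 // => a _ /=.
  rewrite linear_sum raddf_sum big1 // => i _ /=.
  by rewrite linearZ /= !mcoeff0M L_irrel mulr0 mul0r.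
pose im v := exists ga, top_dual (Defs.eta L ga) = v.
have im_lin a u v : im u -> im v -> im (a *: u + v).
  by move=> [ga <-] [de <-]; exists (a *: ga + de); rewrite !linearP.
have im0 : im 0 by exists 0; rewrite !linear0.
have im_sum I (r : seq I) (x : I -> R) w :
    (forall i, im (w i)) -> im (\sum_(i <- r) x i *: w i).
  by move=> hw; elim/big_rec: _ => // i v _; apply: im_lin.
have im_rel t : im (row_relation t).
  case: t => -[i b] c /=; have [->|neq] := eqVneq b c; first by rewrite subrr.
  exists (((-1) ^+ (b + c) * (-1) ^+ (c < b)%N) *: linfun (sub_coord b c i)).
  rewrite 2!linearZ /= (top_dual_sub_coord n_ge2) // scalerA.
  by rewrite -exprD -signr_odd -expr2 sqrr_sign scale1r.
rewrite inE => /asboolP[f hf]; have [ga hga] : im (top_dual al).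
  rewrite hf; elim/big_rec: _ => // j v _ im_v.
  rewrite -(scale1r ('X_j *: f j)); apply: im_lin im_v.
  have ->: 'X_j *: f j = \sum_c f j c 0 *: ('X_j *: delta_mx c 0).
    rewrite {1}[f j]matrix_sum_delta scaler_sumr; apply: eq_bigr => c _.
    by rewrite big_ord1 !scalerA mulrC.
  apply: (im_sum) => c; have [P ->] := L_span j c; exact: im_sum.
by apply/asboolP; exists ga; apply: (top_dual_inj n_ge2).
Qed.

Lemma coker_eta_iso :
  graded_iso (gshift (- (n.+1 * n.-1)%N%:Z) (coker_eta L))
             (gquot (irrel_submod (gfree k n n))).
Proof.
pose V := gfree k n n.
pose Q := quot_module (irrel_submod V).
pose g al : Q := \pi_Q (top_dual al).
have g_linear : linear g.
  by move=> a x y; rewrite /g linearP pi_quotD -pi_quot_scale.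
pose gM := GRing.isLinear.Build R 'Hom(F1, R^o) Q _ g g_linear.
pose gL : {linear 'Hom(F1, R^o) -> Q} := HB.pack g gM.
have gK al : gL al = 0 <-> al \in submod_pred (image_submod (Defs.eta L)).
  by rewrite image_eta_irrel; apply: pi_quot_eq0.
have g_onto w : exists al, gL al = w.
  have [al hal] := top_dual_onto n_ge2 (repr w).
  by exists al; rewrite /= /g hal reprK.
have [f f_bij f_pi] := quot_linear_bij g_onto gK.
exists f; split=> // t x; split.
  move=> [al [hal ->]]; exists (top_dual al); split; last exact: f_pi.
  exact/dual_pieceP.
move=> [v [hv fx]]; have [al hal] := top_dual_onto n_ge2 v.
exists al; split; first by apply/dual_pieceP; rewrite hal.
by apply: (bij_inj f_bij); rewrite f_pi fx /= /g hal.
Qed.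

End CokernelIso.

(** * General linear sections *)

Section DegreeOne.
Variables (k : fieldType) (D n : nat).

Lemma dhomog1_sum (p : {mpoly k[D]}) : p \is 1.-homog ->
  p = \sum_v p@_U_(v) *: 'X_v.
Proof.
move=> hp; pose A : 'M[k]_(1, D) := \row_v p@_U_(v).
have ->: \sum_v p@_U_(v) *: 'X_v = row_form A 0.
  by apply: eq_bigr => v _; rewrite mxE.
apply/mpolyP => m; have [/mdeg1P[v /eqP->]|m_neq1] := boolP (mdeg m == 1%N).
  by rewrite mcoeff_row_form mxE.
by rewrite (dhomog_nemf_coeff hp) // (dhomog_nemf_coeff (row_form_homog A 0)).
Qed.

Lemma pihomog_graded (pi : {linear {mpoly k[D]} -> {mpoly k[n]}}) d p :
  (forall d q, q \is d.-homog -> pi q \is d.-homog) ->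
  pihomog mdeg d (pi p) = pi (pihomog mdeg d p).
Proof.
move=> pi_homog; rewrite {1}[p]mpolyE [pihomog mdeg d p]pihomogE.
rewrite linear_sum /= linear_sum /= linear_sum /= [RHS]big_mkcond.
apply: eq_bigr => m _ /=.
have piX : pi (p@_m *: 'X_[m]) \is (mdeg m).-homog.
  by apply/pi_homog/rpredZ; rewrite dhomogX.
case: (eqVneq (mdeg m) d) => [<-|neq]; first exact: pihomog_dE.
by rewrite (pihomog_ne0 neq piX).
Qed.

Lemma graded_onto_linear (pi : {linear {mpoly k[D]} -> {mpoly k[n]}}) :
  (forall d p, p \is d.-homog -> pi p \is d.-homog) ->
  (forall q, exists p, pi p = q) ->
  forall j, exists w : 'I_D -> k, 'X_j = \sum_v w v *: pi 'X_v.
Proof.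
move=> pi_homog pi_onto j; have [p pj] := pi_onto 'X_j.
exists (fun v => (pihomog mdeg 1 p)@_U_(v)).
have <-: pihomog mdeg 1 'X_j = 'X_j :> {mpoly k[n]}.
  by apply/pihomog_dE; rewrite dhomogX; apply/eqP/mdeg1.
rewrite -pj pihomog_graded // {1}(dhomog1_sum (pihomogP _ 1 p)) linear_sum.
by apply: eq_bigr => v _; rewrite linearZ.
Qed.

End DegreeOne.

Section SpanningInSections.
Variables (k : fieldType) (n : nat).
Local Notation R := {mpoly k[n]}.
Local Notation D := (n.+1 * n)%N.
Local Notation s := (D - n)%N.

Lemma section_irrel c (L : 'M[R]_(n.+1, n)) :
  linear_section c L -> forall i a, (L i a)@_0 = 0.
Proof.
move=> [_ [pi [pi_homog _ _ ->]]] i a; rewrite !mxE.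
have piX1 : pi 'X_(mxvec_index i a) \is 1.-homog.
  by apply: pi_homog; rewrite dhomogX; apply/eqP/mdeg1.
by apply/eqP/negPn/negP => /(dhomog_const piX1).
Qed.

(** Evaluation [ev] sends Z_v f_b to pi(Z_v) f_b.  It maps the generic relations
    to those of the section and kills the L_r f_b; since X_j is the image of a
    linear form, X_j f_b is the image of a spanned vector. *)
Lemma section_span c (L : 'M[R]_(n.+1, n)) :
  linear_section c L -> (forall W, spanned c W) ->
  forall j b, exists P, 'X_j *: delta_mx b 0 = \sum_t P t *: row_relation L t.
Proof.
move=> [_ [pi [pi_homog pi_onto pi_ker ->]]] c_span j b.
have [w Xj] := graded_onto_linear pi_homog pi_onto j.
pose z : 'cV[R]_D := \col_v pi 'X_v.
pose ev (W : 'M[k]_(D, n)) : 'cV[R]_n := map_mx (@mpolyC n k) W^T *m z.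
have ev_sum I (r : seq I) (x : I -> k) W :
    ev (\sum_(i <- r) x i *: W i) = \sum_(i <- r) (x i)%:MP *: ev (W i).
  rewrite /ev linear_sum raddf_sum mulmx_suml; apply: eq_bigr => i _.
  by rewrite linearZ /= map_mxZ -scalemxAl.
have ev_delta v a : ev (delta_mx v a) = pi 'X_v *: delta_mx a 0.
  rewrite /ev trmx_delta map_delta_mx; apply/matrixP => i l.
  rewrite ord1 !mxE (bigD1 v) //= big1 => [|u neq]; last first.
    by rewrite !mxE (negPf neq) andbF mul0r.
  by rewrite !mxE !eqxx !andbT addr0 mulrC.
have ev_rel t :
    ev (generic_relation k t) = row_relation (map_mx pi (generic_matrix k n)) t.
  case: t => -[i a] a'; rewrite /ev linearB /= map_mxB mulmxBl -!/(ev _).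
  by rewrite !ev_delta !mxE.
have cz0 : map_mx (@mpolyC n k) c *m z = 0.
  apply/matrixP => r l; rewrite !mxE.
  transitivity (pi (linear_forms c r)).
    rewrite linear_sum; apply: eq_bigr => v _.
    by rewrite !mxE linearZ /= mul_mpolyC.
  exact/pi_ker/in_ideal_gen.
have [P [Y hW]] := c_span (\sum_v w v *: delta_mx v b).
exists (fun t => (P t)%:MP).
transitivity (ev (\sum_v w v *: delta_mx v b)).
  rewrite ev_sum Xj scaler_suml; apply: eq_bigr => v _.
  by rewrite ev_delta scalerA mul_mpolyC.
rewrite hW /ev linearD /= map_mxD mulmxDl -/(ev _) ev_sum trmx_mul trmxK.
rewrite map_mxM -mulmxA cz0 mulmx0 addr0.
by apply: eq_bigr => t _; rewrite ev_rel.
Qed.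

End SpanningInSections.

Theorem theorem2p15 (k : fieldType)
    (k_infinite : forall s : seq k, exists x : k, x \notin s)
    (n : nat) (n_ge3 : (3 <= n)%N) :
  for_general_linear_matrix (fun L : 'M[{mpoly k[n]}]_(n.+1, n) =>
    graded_iso (gshift (- (n.+1 * n.-1)%N%:Z) (coker_eta L))
               (gquot (irrel_submod (gfree k n n))) /\
    graded_iso (gquot (irrel_submod (gfree k n n))) (gresidue k n n)).
Proof.
have [c0 [c0_free c0_span]] := spanning_example k n_ge3.
have [U [U_open Uc0 U_good]] := spanning_is_open c0_free c0_span.
exists U; split=> //; first by exists c0.
move=> c /U_good[c_free c_span]; split; first exact: linear_section_exists.
move=> L L_section; split; last exact: quot_irrel_residue.
apply: coker_eta_iso; first exact: ltnW.
  exact: section_irrel L_section.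
exact: section_span L_section c_span.
Qed.
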